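(* Let $N = N(\iota)$ be an increasing sequence of positive integers and, for each $\iota$, let $\bm A, \bm B \in \mathbb{C}^{N\times N}$ be random orthogonal projection matrices. Suppose that for some $\alpha,\beta\in(0,1)$, $$\lim_{\iota\to\infty}\Big(\tfrac1N\mathbb{E}\operatorname{Tr}(\bm A)-\alpha\Big)=0,\qquad \lim_{\iota\to\infty}\Big(\tfrac1N\mathbb{E}\operatorname{Tr}(\bm B)-\beta\Big)=0,$$ and, for every integer $k\ge 1$, $$\lim_{\iota\to\infty}\frac1N\mathbb{E}\operatorname{Tr}\Big(\big((\bm A-\alpha\bm I_N)(\bm B-\beta\bm I_N)\big)^k\Big)=0.$$ Then the empirical spectral distribution of $\bm A\bm B\bm A$ converges in moments to $\mathsf{MANOVA}(\alpha,\beta)$.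
   Context: For $\alpha,\beta\in(0,1)$, $\mathsf{MANOVA}(\alpha,\beta)$ is the probability measure on $\mathbb{R}$ $$d\mu(x)=\frac{\sqrt{(r_+-x)(x-r_-)}}{2\pi x(1-x)}\mathbf 1_{[r_-,r_+]}(x)\,dx+(1-\min\{\alpha,\beta\})\delta_0+\max\{\alpha+\beta-1,0\}\delta_1,$$ where $r_\pm=r_\pm(\alpha,\beta)=\big(\sqrt{\alpha(1-\beta)}\pm\sqrt{\beta(1-\alpha)}\big)^2$ and $\delta_c$ is the Dirac mass at $c$. The empirical spectral distribution (e.s.d.) of a Hermitian $N\times N$ matrix with eigenvalues $\lambda_1,\dots,\lambda_N$ is $\frac1N\sum_i\delta_{\lambda_i}$. Random probability measures $\mu_\iota$ converge in moments to a deterministic $\mu$ if for every $k\ge1$, $\lim_\iota\mathbb{E}\int x^k d\mu_\iota(x)=\int x^k d\mu(x)$ (finite). Powers bind before the trace. *)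

(* Defs.v *)
From HB Require Import structures.
From mathcomp Require Import all_boot all_order all_algebra.
From mathcomp Require Import all_classical all_reals all_analysis.
From mathcomp.real_closed Require Import complex.

Set Implicit Arguments.
Unset Strict Implicit.
Unset Printing Implicit Defensive.

Import Order.TTheory GRing.Theory Num.Theory.
Local Open Scope ring_scope.

Definition adjmx (R : rcfType) (n : nat) (M : 'M[R[i]]_n) : 'M[R[i]]_n :=
  map_mx (@conjc R) M^T.

Definition is_orth_proj (R : rcfType) (n : nat) (M : 'M[R[i]]_n) : Prop :=
  M *m M = M /\ adjmx M = M.

(* The eigenvalues of M, listed with algebraic multiplicity: the roots
   (with multiplicity) of the monic characteristic polynomial. *)
Definition eigenvalues (R : rcfType) (n : nat) (M : 'M[R[i]]_n) : seq R[i] :=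
  sval (closed_field_poly_normal (char_poly M)).

(* k-th moment of the empirical spectral distribution
   (1/n) sum_i delta_{lambda_i} of a Hermitian matrix M; its eigenvalues are
   real, and we read them in R via their real part:
   int x^k d(esd M) = (1/n) sum_i lambda_i^k. *)
Definition esd_moment (R : rcfType) (n : nat) (M : 'M[R[i]]_n) (k : nat) : R :=
  (n%:R)^-1 * \sum_(z <- eigenvalues M) (complex.Re z) ^+ k.

Definition ntr (R : rcfType) (n : nat) (M : 'M[R[i]]_n) : R[i] :=
  (n%:R)^-1 * \tr M.

Definition manova_rm (R : realType) (a b : R) : R :=
  (Num.sqrt (a * (1 - b)) - Num.sqrt (b * (1 - a))) ^+ 2.
Definition manova_rp (R : realType) (a b : R) : R :=
  (Num.sqrt (a * (1 - b)) + Num.sqrt (b * (1 - a))) ^+ 2.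

Definition manova_density (R : realType) (a b : R) (x : R) : R :=
  Num.sqrt ((manova_rp a b - x) * (x - manova_rm a b))
  / (2 * pi * x * (1 - x)).

Definition manova_moment (R : realType) (a b : R) (k : nat) : \bar R :=
  ((\int[lebesgue_measure]_(x in `[manova_rm a b, manova_rp a b]%classic)
      (x ^+ k * manova_density a b x)%:E)
   + ((1 - Num.min a b) * 0 ^+ k + Num.max (a + b - 1) 0 * 1 ^+ k)%:E)%E.

(* Main.v *)
(* Let a = A - alpha, b = B - beta and X = 1 - (A - B)^2. X is central in the
   algebra generated by A and B, A X = A B A, and (a b)^2 = (X - s)(a b) - D with
   s = alpha + beta - 2 alpha beta and D = alpha beta (1 - alpha)(1 - beta).
   Hence, up to explicit terms in tr A and tr B, tr (a b)^k is the value at the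
   Dickson polynomial t_k of the functional x^j |-> tr (A B A)^j. Since the t_k
   span all polynomials, the hypotheses determine the limits of all the moments.
   On the MANOVA side, the substitution x = s + 2 sqrt D cos phi turns t_k into
   2 D^(k/2) cos (k phi) and the square root into 2 sqrt D sin phi.
   Differences of consecutive moments lose the factor 1 - x of the denominator
   and the atom at 1, so they are semicircle moments, which the trigonometric
   integrals give on every t_k. Only the first moment involves a genuine Cauchy
   transform, an integral of the Poisson kernel. *)

Require Import Defs.
From HB Require Import structures.
From mathcomp Require Import all_boot all_order all_algebra.
From mathcomp Require Import all_classical all_reals all_analysis.
From mathcomp.real_closed Require Import complex.
From mathcomp Require Import measurable_realfun ring lra spectral.
Import Order.TTheory GRing.Theory Num.Theory.
Import numFieldNormedType.Exports.
Local Open Scope ring_scope.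
Local Open Scope classical_set_scope.

(** * Dickson polynomials evaluated on moment sequences *)

Section Dickson.
Variables (K : comNzRingType) (s D : K).

(* [dickson s D m k n] is the value at [x^n t_k(x)] of the linear functional
   [x^j |-> m j], where [t_k] is the Dickson polynomial characterized by
   [t_k(s + z + D / z) = z^k + (D / z)^k]. *)
Fixpoint dickson (m : nat -> K) (k n : nat) : K :=
  match k with
  | 0 => m n *+ 2
  | 1 => m n.+1 - s * m n
  | (k'.+1 as k1).+1 => dickson m k1 n.+1 - s * dickson m k1 n - D * dickson m k' n
  end.

Lemma dicksonS (m : nat -> K) k n :
  dickson m k.+2 n = dickson m k.+1 n.+1 - s * dickson m k.+1 n - D * dickson m k n.
Proof. by []. Qed.

Lemma nat_ind2 (Q : nat -> Prop) :
  Q 0%N -> Q 1%N -> (forall k, Q k -> Q k.+1 -> Q k.+2) -> forall k, Q k.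
Proof.
move=> Q0 Q1 QS k; suff [] : Q k /\ Q k.+1 by [].
by elim: k => [//|k [Qk Qk1]]; split=> //; apply: QS.
Qed.

Lemma dickson_shift (m : nat -> K) k n : dickson (fun j => m j.+1) k n = dickson m k n.+1.
Proof.
elim/nat_ind2: k n => [//|//|k IH0 IH1] n.
by rewrite !dicksonS !IH0 !IH1.
Qed.

Lemma dicksonB (m m' : nat -> K) k n :
  dickson (fun j => m j - m' j) k n = dickson m k n - dickson m' k n.
Proof.
elim/nat_ind2: k n => [|/=|k IH0 IH1] n; first by rewrite /= mulrnBl.
  by ring.
by rewrite !dicksonS !IH0 !IH1; ring.
Qed.

Lemma eq_dickson (m m' : nat -> K) k n : m =1 m' -> dickson m k n = dickson m' k n.
Proof. by move=> /funext ->. Qed.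

Lemma dicksonM (m : nat -> K) c k n :
  dickson (fun j => m j * c) k n = dickson m k n * c.
Proof.
elim/nat_ind2: k n => [||k IH0 IH1] n; rewrite ?dicksonS ?IH0 ?IH1 /=; ring.
Qed.

(** With [dicksonS_shift], the recurrence solved for the higher power of x: the values at n = 0 for
    all k thereby determine those at every n. *)
Lemma dickson0_shift (m : nat -> K) n :
  dickson m 0 n.+1 = dickson m 1 n *+ 2 + s * dickson m 0 n.
Proof. by rewrite /=; ring. Qed.

Lemma dicksonS_shift (m : nat -> K) k n :
  dickson m k.+1 n.+1 = dickson m k.+2 n + s * dickson m k.+1 n + D * dickson m k n.
Proof. by rewrite dicksonS; ring. Qed.

End Dickson.
Arguments dickson {K}.

(** * The algebra of two idempotents and the traces of its words *)

Section TwoProjections.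
Variables (R : realType) (n : nat).
Implicit Types M N A B : 'M[R[i]]_n.

(** Taking the real part keeps real linearity and cyclicity, the two properties on which the trace
    recurrences rest. *)
Definition rtr M : R := complex.Re (ntr M).

Lemma rtrD M N : rtr (M + N) = rtr M + rtr N.
Proof. by rewrite /rtr /ntr mxtraceD mulrDr raddfD. Qed.
Lemma rtrN M : rtr (- M) = - rtr M.
Proof. by rewrite /rtr /ntr raddfN mulrN raddfN. Qed.
Lemma rtrB M N : rtr (M - N) = rtr M - rtr N.
Proof. by rewrite rtrD rtrN. Qed.

Lemma rtrZ (c : R) M : rtr ((c%:C)%C *: M) = c * rtr M.
Proof.
rewrite /rtr /ntr mxtraceZ mulrCA.
by case: (_ * \tr M) => x y /=; rewrite mul0r subr0.
Qed.

Lemma rtrC M N : rtr (M * N) = rtr (N * M).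
Proof. by rewrite /rtr /ntr -!mulmxE mxtrace_mulC. Qed.

Lemma rtr1 : (0 < n)%N -> rtr 1 = 1.
Proof.
move=> n0; rewrite /rtr /ntr mxtrace1 mulVf //.
by rewrite pnatr_eq0 -lt0n.
Qed.

Variables (A B : 'M[R[i]]_n) (a b : R).
Hypotheses (AA : A * A = A) (BB : B * B = B) (n0 : (0 < n)%N).

Let s : R := a + b - 2 * a * b.
Let D : R := a * b * (1 - a) * (1 - b).
(* [Xc = 1 - (A - B)^2] is central in the algebra generated by A and B; on a
   generic two-dimensional block of the pair it is cos^2 of the angle. *)
Let Xc : 'M[R[i]]_n := 1 - A - B + A * B + B * A.
Let sc (c : R) : 'M[R[i]]_n := (c%:C)%C%:M.
Let MM : 'M[R[i]]_n := (A - sc a) * (B - sc b).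
(** The zeroth term is chosen symmetric in A and B rather than equal to the trace 1 of the identity,
    so that [rtr_center] holds from j = 0 on. *)
Let m (j : nat) : R := if j is 0%N then (rtr A + rtr B) / 2
                        else rtr ((A * B * A) ^+ j).

Lemma mul_scalar_l c M : sc c * M = (c%:C)%C *: M.
Proof. by rewrite /sc -mulmxE mul_scalar_mx. Qed.
Lemma mul_scalar_r c M : M * sc c = (c%:C)%C *: M.
Proof. by rewrite /sc -mulmxE mul_mx_scalar. Qed.

Lemma mulAX : A * Xc = A * B * A.
Proof.
rewrite /Xc !mulrDr !mulrN mulr1 AA !mulrA AA.
by rewrite subrr add0r addNr add0r.
Qed.

Lemma mulXA : Xc * A = A * B * A.
Proof.
rewrite /Xc !mulrDl !mulNr mul1r -!mulrA AA subrr add0r.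
by rewrite addrAC addNr add0r.
Qed.

Lemma mulBX : B * Xc = B * A * B.
Proof.
rewrite /Xc !mulrDr !mulrN mulr1 BB !mulrA BB.
move: (B * A) (B * A * B) => U V.
by apply/matrixP => i j; rewrite !mxE; ring.
Qed.

Lemma mulXB : Xc * B = B * A * B.
Proof.
rewrite /Xc !mulrDl !mulNr mul1r -!mulrA BB !mulrA.
move: (A * B) (B * A * B) => U V.
by apply/matrixP => i j; rewrite !mxE; ring.
Qed.

Lemma sc_central c M : GRing.comm (sc c) M.
Proof. by rewrite /GRing.comm mul_scalar_l mul_scalar_r. Qed.

Lemma comm_center_word : GRing.comm Xc MM.
Proof.
have cA : GRing.comm Xc A by rewrite /GRing.comm mulXA mulAX.
have cB : GRing.comm Xc B by rewrite /GRing.comm mulXB mulBX.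
by apply: commrM; apply: commrB => //; apply/commr_sym/sc_central.
Qed.

(** Since Q^2 - Q = 0, the shifts by c and 1 - c are inverse to each other up to a scalar. *)
Lemma proj_shift (Q : 'M[R[i]]_n) c : Q * Q = Q ->
  (Q - sc c) * (Q - sc (1 - c)) = sc (c * (1 - c)).
Proof.
move=> QQ; rewrite mulrBl !mulrBr QQ !mul_scalar_l mul_scalar_r.
have -> : (((1 - c)%:C)%C : R[i]) = 1 - (c%:C)%C by rewrite rmorphB rmorph1.
rewrite /sc; apply/matrixP => i j; rewrite !mxE. rewrite !(rmorphB, rmorphM, rmorph1) /=.
by case: (i == j); rewrite ?mulr1n ?mulr0n; ring.
Qed.

(** A Cayley-Hamilton identity with central coefficients: [M'] acts as the adjugate of [MM], their
    product being the scalar D and their sum Xc - s. *)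
Lemma word_sq : MM * MM = Xc * MM - sc s * MM - sc D.
Proof.
pose M' := (B - sc (1 - b)) * (A - sc (1 - a)).
have MM' : MM * M' = sc D.
  rewrite /MM /M' -mulrA [(B - sc b) * _]mulrA proj_shift //.
  rewrite (sc_central _ (A - sc (1 - a))) mulrA proj_shift // mul_scalar_l.
  rewrite /sc; apply/matrixP => i j; rewrite !mxE.
  rewrite mulrnAr -rmorphM.
  by congr (_ *+ _); apply: (congr1 (fun x => (x%:C)%C)); rewrite /D; ring.
have sumE : M' = Xc - sc s - MM.
  rewrite /M' /MM /Xc !mulrBr !mulrBl !mul_scalar_l !mul_scalar_r.
  move: (A * B) (B * A) => U V.
  have one : (1 : 'M[R[i]]_n) = 1%:M by [].
  rewrite /sc /s one; apply/matrixP => i j; rewrite !mxE.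
  rewrite !(rmorphB, rmorphD, rmorphM, rmorph1, rmorph_nat) /=.
  case: (i == j); rewrite ?mulr1n ?mulr0n; ring.
have cM : Xc * MM = MM * Xc := comm_center_word.
have cs : sc s * MM = MM * sc s := sc_central _ _.
rewrite cM cs -MM' sumE !mulrBr.
move: (MM * Xc) (MM * sc s) (MM * MM) => U V W.
by apply/matrixP => i j; rewrite !mxE; ring.
Qed.

Let F (k j : nat) : R := rtr (Xc ^+ j * MM ^+ k).

Lemma rtr_word_rec k j : F k.+2 j = F k.+1 j.+1 - s * F k.+1 j - D * F k j.
Proof.
rewrite /F -!rtrZ -!rtrB; congr rtr.
rewrite !exprS [MM * (MM * _)]mulrA word_sq !mulrBl !mulrBr -!mul_scalar_l.
rewrite -![Xc * Xc ^+ j]exprS exprSr -!mulrA.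
by rewrite ![Xc ^+ j * (sc _ * _)]mulrA -!(sc_central _ (Xc ^+ j)) !mulrA.
Qed.

Lemma comm_center_exp (Q : 'M[R[i]]_n) j : GRing.comm Xc Q ->
  Xc ^+ j * Q = Q * Xc ^+ j.
Proof. by move=> cQ; apply/esym/commrX/commr_sym. Qed.

Lemma comm_center_A : GRing.comm Xc A. Proof. by rewrite /GRing.comm mulXA mulAX. Qed.
Lemma comm_center_B : GRing.comm Xc B. Proof. by rewrite /GRing.comm mulXB mulBX. Qed.

Lemma center_exp_mulA j : Xc ^+ j.+1 * A = (A * B * A) ^+ j.+1.
Proof.
elim: j => [|j IH]; first by rewrite !expr1 mulXA.
have ABAX : A * B * A * Xc = A * B * A * (A * B * A).
  by rewrite -[LHS]mulrA mulAX !mulrA -[in RHS](mulrA (A * B) A A) AA.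
by rewrite exprSr -mulrA comm_center_A mulrA IH exprSr -mulrA ABAX mulrA -!exprSr.
Qed.

Lemma rtr_centerS_A j : rtr (Xc ^+ j.+1 * A) = m j.+1.
Proof. by rewrite center_exp_mulA. Qed.

(** Cyclicity brings the last Q to the front; it commutes past the power of Xc and is absorbed by
    the other Q. *)
Lemma rtr_absorb (Q U : 'M[R[i]]_n) j : Q * Q = Q -> GRing.comm Xc Q ->
  rtr (Xc ^+ j * (Q * U * Q)) = rtr (Xc ^+ j * (Q * U)).
Proof.
move=> QQ cQ.
by rewrite mulrA rtrC mulrA -comm_center_exp // -mulrA (mulrA Q Q) QQ.
Qed.

Lemma rtr_center_AB j : rtr (Xc ^+ j * (A * B)) = m j.+1.
Proof. by rewrite -rtr_centerS_A exprSr -mulrA mulXA rtr_absorb //; exact: comm_center_A. Qed.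

Lemma rtr_center_BA j : rtr (Xc ^+ j * (B * A)) = m j.+1.
Proof.
by rewrite -rtr_center_AB mulrA rtrC mulrA -(comm_center_exp _ _ comm_center_A) -mulrA.
Qed.

Lemma rtr_centerS_B j : rtr (Xc ^+ j.+1 * B) = m j.+1.
Proof. by rewrite -rtr_center_BA exprSr -mulrA mulXB rtr_absorb //; exact: comm_center_B. Qed.

Let kap := 1 - rtr A - rtr B.
Let del := (rtr A - rtr B) / 2.

Lemma rtr_center_A j : rtr (Xc ^+ j * A) = m j + (j == 0%N)%:R * del.
Proof.
case: j => [|j]; last by rewrite rtr_centerS_A mul0r addr0.
by rewrite expr0 mul1r /m /del /= mul1r; field.
Qed.

Lemma rtr_center_B j : rtr (Xc ^+ j * B) = m j - (j == 0%N)%:R * del.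
Proof.
case: j => [|j]; last by rewrite rtr_centerS_B mul0r subr0.
by rewrite expr0 mul1r /m /del /= mul1r; field.
Qed.

(** When one factor Xc is expanded, the terms in A and B cancel 2 m j, the words A B and B A bring m
    j.+1 each, and [kap] is carried along. *)
Lemma rtr_center j : rtr (Xc ^+ j) = m j *+ 2 + kap.
Proof.
elim: j => [|j IH].
  by rewrite expr0 rtr1 // /m /kap; field.
rewrite exprSr {2}/Xc !mulrDr !mulrN mulr1 !(rtrD, rtrN).
by rewrite IH rtr_center_A rtr_center_B rtr_center_AB rtr_center_BA; ring.
Qed.

(* The two correction terms are the contributions of the common eigenvectors of
   A and B, on which [Xc] is 1 or 0. *)
Lemma rtr_word k j :
  rtr (Xc ^+ j * MM ^+ k) = dickson s D m k j + kap * (a * b) ^+ k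
    + (j == 0%N)%:R * del * ((- b * (1 - a)) ^+ k - (- a * (1 - b)) ^+ k).
Proof.
elim/nat_ind2: k j => [||k IH0 IH1] j.
- by rewrite expr0 !mulr1 rtr_center /= subrr mulr0 addr0.
- have ME : MM = A * B - (a%:C)%C *: B - (b%:C)%C *: A + sc (a * b).
    rewrite /MM mulrBl !mulrBr !mul_scalar_l mul_scalar_r.
    rewrite /sc; move: (A * B) => U.
    by apply/matrixP => i l; rewrite !mxE rmorphM mulrnAr; ring.
  have Zr c (Q : 'M[R[i]]_n) : Xc ^+ j * (c *: Q) = c *: (Xc ^+ j * Q).
    by rewrite -!mulmxE -scalemxAr.
  rewrite expr1 ME !(mulrDr, mulrBr) !mulrN !Zr mul_scalar_r !(rtrD, rtrN) !rtrZ.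
  rewrite rtr_center rtr_center_AB rtr_center_B rtr_center_A /= !expr1.
  by rewrite /s; ring.
(* Each correction obeys the recurrence: a b is a root of z^2 = (1 - s) z - D (the value 1 of Xc),
   while - b (1 - a) and - a (1 - b) are the roots of z^2 = - s z - D (the value 0). *)
- have := rtr_word_rec k j; rewrite /F => ->; rewrite !IH0 !IH1 dicksonS.
  rewrite !(exprS _ k.+1) !(exprS _ k).
  move: (dickson _ _ _ _ _) (dickson _ _ _ _ _) (dickson _ _ _ _ _) => t0 t1 t2.
  move: ((a * b) ^+ k) ((- b * (1 - a)) ^+ k) ((- a * (1 - b)) ^+ k) => p q r.
  by rewrite /s /D; case: j => [|j] /=; ring.
Qed.

End TwoProjections.

(** * Exchange of Dickson evaluation and integration *)

Section DicksonIntegral.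
Context (d : measure_display) (T : measurableType d) (R : realType).
Variables (mu : {measure set T -> \bar R}) (E : set T) (mE : measurable E).
Variables (s D : R) (m : nat -> T -> R).
Hypothesis im : forall n, mu.-integrable E (EFin \o m n).

Lemma integrable_lin3 (f g h : T -> R) (x y : R) :
  mu.-integrable E (EFin \o f) -> mu.-integrable E (EFin \o g) ->
  mu.-integrable E (EFin \o h) ->
  mu.-integrable E (EFin \o (fun t => f t - x * g t - y * h t)) /\
  (\int[mu]_(t in E) (f t - x * g t - y * h t))%R =
  (\int[mu]_(t in E) f t)%R - x * (\int[mu]_(t in E) g t)%R
    - y * (\int[mu]_(t in E) h t)%R.
Proof.
move=> fi gi hi.
have Zi z k : mu.-integrable E (EFin \o k) ->
    mu.-integrable E (EFin \o (fun t => z * k t)).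
  by move=> ki; have := integrableZl mE z ki; apply: eq_integrable.
have fgi : mu.-integrable E (EFin \o (fun t => f t - x * g t)).
  by have := integrableB mE fi (Zi x g gi); apply: eq_integrable.
split; last by rewrite RintegralB ?RintegralB ?RintegralZl //; exact: Zi.
by have := integrableB mE fgi (Zi y h hi); apply: eq_integrable.
Qed.

(** Serves twice: for the angular integrals of the semicircle and for expectations over the random
    projections. *)
Lemma dickson_Rintegral k n :
  mu.-integrable E (EFin \o (fun x => dickson s D (m ^~ x) k n)) /\
  (\int[mu]_(x in E) dickson s D (m ^~ x) k n)%R =
  dickson s D (fun j => (\int[mu]_(x in E) m j x)%R) k n.
Proof.
elim/nat_ind2: k n => [||k IH0 IH1] n.
- have [] := integrable_lin3 _ _ _ (-1) 0 (im n) (im n) (im n).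
  have -> : (fun t => m n t - -1 * m n t - 0 * m n t)
      = (fun x => dickson s D (m ^~ x) 0 n) by apply/funext => t /=; ring.
  by move=> ? ->; split=> //=; ring.
- have [] := integrable_lin3 _ _ _ s 0 (im n.+1) (im n) (im n).
  have -> : (fun t => m n.+1 t - s * m n t - 0 * m n t)
      = (fun x => dickson s D (m ^~ x) 1 n) by apply/funext => t /=; ring.
  by move=> ? ->; split=> //=; ring.
- have [IH1' E1'] := IH1 n.+1; have [IH1n E1n] := IH1 n; have [IH0n E0n] := IH0 n.
  have [] := integrable_lin3 _ _ _ s D IH1' IH1n IH0n.
  by rewrite E1' E1n E0n.
Qed.

End DicksonIntegral.

(** * The substitution x = s + r cos phi *)

Section CosSubstitution.
Variable R : realType.
Implicit Types (f F h : R -> R) (a b c s r phi : R).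
Local Notation mu := (@lebesgue_measure R).

Lemma integral_is_derive f F a b : a < b -> continuous f ->
  (forall x : R, is_derive x 1 F (f x)) ->
  (\int[mu]_(x in `[a, b]) (f x)%:E = (F b - F a)%:E)%E.
Proof.
move=> ab cf dF; rewrite (@continuous_FTC2 _ f F) //.
- exact: continuous_subspaceT.
- have cF x : {for x, continuous F}.
    by apply/differentiable_continuous/derivable1_diffP; case: (dF x).
  split; first by move=> x _; case: (dF x).
  + exact/cvg_at_right_filter/cF.
  + exact/cvg_at_left_filter/cF.
- by move=> x _; rewrite derive1E; case: (dF x).
Qed.

(** The unnormalized semicircle profile of center s and radius r. *)
Definition wigner s r x := Num.sqrt ((s + r - x) * (x - (s - r))).

Lemma continuous_wigner s r : continuous (wigner s r).
Proof.
move=> x; rewrite /wigner.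
apply: (@continuous_comp _ _ _ (fun x => (s + r - x) * (x - (s - r))) Num.sqrt).
  by apply: cvgM; apply: cvgB; (exact: cvg_cst || exact: cvg_id).
exact: sqrt_continuous.
Qed.

Lemma wigner_cos s r phi : 0 <= r -> 0 <= phi <= pi ->
  wigner s r (s + r * cos phi) = r * sin phi.
Proof.
move=> r0 phi0.
have -> : wigner s r (s + r * cos phi) = Num.sqrt ((r * sin phi) ^+ 2).
  rewrite /wigner; congr Num.sqrt.
  by rewrite exprMn sin2cos2; ring.
by rewrite sqrtr_sqr ger0_norm // mulr_ge0 // sin_ge0_pi.
Qed.

(** One factor r sin phi comes from the square root and one from the Jacobian; the substitution is
    decreasing, which absorbs the sign of the latter. *)
Lemma integral_wigner_cos s r h : 0 < r -> {within `[s - r, s + r], continuous h} ->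
  (\int[mu]_(x in `[(s - r)%R, (s + r)%R]) (h x * wigner s r x)%:E =
   \int[mu]_(phi in `[0%R, pi]) (h (s + r * cos phi) * (r * sin phi) ^+ 2)%:E)%E.
Proof.
move=> r0 ch.
pose H phi := s + r * cos phi.
have dH (phi : R) : is_derive phi 1 H (- (r * sin phi)).
  by apply: is_derive_eq; rewrite /GRing.scale /=; ring.
have H' : H^`() = (fun phi => - (r * sin phi)).
  by apply/funext => phi; rewrite derive1E; case: (dH phi).
have cH' : continuous (fun phi : R => - (r * sin phi)).
  move=> x; apply: cvgN; apply: cvgM; [exact: cvg_cst|exact: continuous_sin].
have H0 : H 0 = s + r by rewrite /H cos0 mulr1.
have Hpi : H pi = s - r by rewrite /H cospi mulrN1.
have := @integration_by_substitution_decreasing R H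
  (fun x => h x * wigner s r x) 0 pi (pi_ge0 R).
rewrite H0 Hpi H' => ->.
- apply: eq_integral => phi; rewrite inE /= in_itv /= => phi0.
  by rewrite /= !fctE /= wigner_cos ?(ltW r0) // opprK -mulrA -expr2.
- by move=> x y x0 y0 xy; rewrite /H ltrD2l ltr_pM2l // ltr_cos.
- by move=> x _; exact: cH'.
- apply/cvg_ex; eexists; exact/cvg_at_right_filter/cH'.
- apply/cvg_ex; eexists; exact/cvg_at_left_filter/cH'.
- have cH x : {for x, continuous H}.
    by apply/differentiable_continuous/derivable1_diffP; case: (dH x).
  split; first by move=> x _; case: (dH x).
  + exact/cvg_at_right_filter/cH.
  + exact/cvg_at_left_filter/cH.
- move=> x; apply: cvgM; first exact: ch.
  exact: (continuous_subspaceT (@continuous_wigner s r)).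
Qed.

End CosSubstitution.
Arguments wigner {R}.

(** * Semicircle moments on the Dickson polynomials *)

Section Semicircle.
Variable R : realType.
Implicit Types (f F h : R -> R) (a b c s r rho phi x : R).
Local Notation mu := (@lebesgue_measure R).

(** This is t_k at z = rho e^(i phi), D = rho^2; the recurrence turns into the addition formula for
    (k+1) phi plus or minus phi. *)
Lemma dickson_cos s rho phi k n :
  dickson s (rho ^+ 2) (fun j => (s + 2 * rho * cos phi) ^+ j) k n =
  (s + 2 * rho * cos phi) ^+ n * (2 * rho ^+ k * cos (k%:R * phi)).
Proof.
elim/nat_ind2: k n => [||k IH0 IH1] n.
- by rewrite /= mul0r cos0 expr0; ring.
- by rewrite /= mul1r expr1 exprS; ring.
- rewrite dicksonS IH0 !IH1 exprS.
  have -> : k.+2%:R * phi = k.+1%:R * phi + phi by rewrite -[k.+2%:R]natr1; ring.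
  have -> : k%:R * phi = k.+1%:R * phi - phi by rewrite -[k.+1%:R]natr1; ring.
  by rewrite cosB cosD !exprS; ring.
Qed.

Lemma sin_natpi n : sin (n%:R * pi) = 0 :> R.
Proof.
elim: n => [|n IH]; first by rewrite mul0r sin0.
by rewrite -natr1 mulrDl mul1r sinDpi IH oppr0.
Qed.

(** The case c = 0 does occur below, for the frequencies k and k - 2. *)
Let cos_prim c phi : R := if c == 0 then phi else sin (c * phi) / c.

Lemma is_derive_cos_prim c (phi : R) : is_derive phi 1 (cos_prim c) (cos (c * phi)).
Proof.
rewrite /cos_prim; case: eqVneq => [->|c0].
  by rewrite mul0r cos0; exact: is_derive_id.
apply: is_derive_eq; rewrite /GRing.scale /=. by field.
Qed.

Lemma cos_prim0 c : cos_prim c 0 = 0.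
Proof. by rewrite /cos_prim; case: eqP => // _; rewrite mulr0 sin0 mul0r. Qed.

Lemma cos_mul_sin2 c phi : cos (c * phi) * sin phi ^+ 2 =
  cos (c * phi) / 2 - cos ((c + 2) * phi) / 4 - cos ((c - 2) * phi) / 4.
Proof.
rewrite mulrBl mulrDl cosB cosD.
have -> : 2 * phi = phi *+ 2 by ring.
by rewrite cos_mulr2n sin2cos2; field.
Qed.

(** Among the frequencies k, k + 2 and k - 2 only a zero one contributes: for the others the
    antiderivative vanishes at both 0 and [pi]. *)
Lemma integral_cos_sin2 c k :
  (\int[mu]_(phi in `[0%R, pi]) (c * (cos (k%:R * phi) * sin phi ^+ 2))%:E =
   (c * pi * ((k == 0%N)%:R / 2 - (k == 2%N)%:R / 4))%:E)%E.
Proof.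
pose F phi := c * (cos_prim k%:R phi / 2 - cos_prim (k%:R + 2) phi / 4 - cos_prim (k%:R - 2) phi / 4).
have dF (x : R) : is_derive x 1 F (c * (cos (k%:R * x) * sin x ^+ 2)).
  rewrite cos_mul_sin2; have dK := is_derive_cos_prim.
  apply: is_derive_eq; rewrite /GRing.scale /=; ring.
have cf : continuous (fun x : R => c * (cos (k%:R * x) * sin x ^+ 2)).
  move=> x; apply: cvgM; first exact: cvg_cst.
  apply: cvgM; last by apply: cvgM; exact: continuous_sin.
  apply: continuous_comp; last exact: continuous_cos.
  by apply: cvgM; [exact: cvg_cst|exact: cvg_id].
rewrite (integral_is_derive _ _ _ _ _ (pi_gt0 R) cf dF); congr (_%:E); rewrite /F !cos_prim0 /cos_prim.
have k2 : (k%:R + 2 != 0 :> R) by rewrite -natrD pnatr_eq0 addn2.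
rewrite (negbTE k2) -natrD !sin_natpi.
have -> : (k%:R - 2 == 0 :> R) = (k == 2%N).
  by rewrite subr_eq0 eqr_nat.
have -> : (k%:R == 0 :> R) = (k == 0%N) by rewrite pnatr_eq0.
case: eqP => [->|k0] /=.
  have -> : (0%:R - 2) * pi = - (pi *+ 2) :> R by ring.
  by rewrite sinN sin2pi; field.
case: (k =P 2%N) => [_|_] /=; rewrite ?mul0r; first by field.
have -> : (k%:R - 2) * pi = k%:R * pi - pi *+ 2 :> R by ring.
by rewrite -[sin (_ - _)]sinD2pi subrK sin_natpi !mul0r; field.
Qed.

(** The factor 1 / (2 pi) is inherited from the MANOVA density, so for r > 0 the total mass is r^2 /
    4. *)
Definition semicircle_moment s r n : R :=
  (\int[mu]_(x in `[(s - r)%R, (s + r)%R]) (x ^+ n / (2 * pi) * wigner s r x))%R.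

Lemma continuous_expn_div n c : continuous (fun x : R => x ^+ n / c).
Proof.
move=> x; apply: cvgM; last exact: cvg_cst.
exact: exprn_continuous.
Qed.

Lemma semicircle_momentE s r n : 0 < r -> semicircle_moment s r n =
  (\int[mu]_(phi in `[0%R, pi])
    ((s + r * cos phi) ^+ n / (2 * pi) * (r * sin phi) ^+ 2))%R.
Proof.
move=> r0; rewrite /semicircle_moment /Rintegral integral_wigner_cos //.
by apply: continuous_subspaceT; exact: continuous_expn_div.
Qed.

Lemma dickson_semicircle s rho k : 0 < rho ->
  dickson s (rho ^+ 2) (semicircle_moment s (2 * rho)) k 0 =
  (k == 0%N)%:R * (2 * rho ^+ 2) - (k == 2%N)%:R * rho ^+ 4.
Proof.
move=> rho0; have r0 : 0 < 2 * rho by rewrite mulr_gt0.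
pose m n phi := (s + 2 * rho * cos phi) ^+ n / (2 * pi) * (2 * rho * sin phi) ^+ 2.
have cm n : continuous (m n).
  move=> x; apply: cvgM; last first.
    apply: (@continuous_comp _ _ _ (fun x => 2 * rho * sin x) (fun y => y ^+ 2)).
      by apply: cvgM; [exact: cvg_cst|exact: continuous_sin].
    exact: exprn_continuous.
  apply: (@continuous_comp _ _ _ (fun x => s + 2 * rho * cos x) (fun y => y ^+ n / (2 * pi))).
    by apply: cvgD; [exact: cvg_cst|apply: cvgM; [exact: cvg_cst|exact: continuous_cos]].
  exact: continuous_expn_div.
have im n : mu.-integrable `[0%R, pi] (EFin \o m n).
  apply: continuous_compact_integrable; first exact: segment_compact.
  exact: continuous_subspaceT.
have -> : semicircle_moment s (2 * rho) = fun n => (\int[mu]_(x in `[0%R, pi]) m n x)%R.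
  by apply/funext => n; rewrite semicircle_momentE.
rewrite -(@dickson_Rintegral _ _ R mu `[0%R, pi]%classic (measurable_itv _) s (rho ^+ 2) m im k 0).2.
rewrite /Rintegral.
under eq_integral => phi _.
  rewrite /m; under eq_dickson => j do rewrite -mulrA.
  rewrite dicksonM dickson_cos expr0 mul1r.
  over.
have pi0 : pi != 0 :> R by rewrite gt_eqF ?pi_gt0.
have e phi : 2 * rho ^+ k * cos (k%:R * phi) * ((2 * pi)^-1 * (2 * rho * sin phi) ^+ 2)
  = (4 * rho ^+ k * rho ^+ 2 / pi) * (cos (k%:R * phi) * sin phi ^+ 2).
  by move: (pi : R) pi0 => q q0; field.
under eq_integral => phi _ do rewrite e.
rewrite integral_cos_sin2 /=.
move: (pi : R) pi0 => q q0.
case: eqP => [->|_] /=; first by field.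
by case: eqP => [->|_] /=; field.
Qed.

End Semicircle.

(** * The Cauchy transform of the semicircle profile *)

Section CauchyTransform.
Variable R : realType.
Implicit Types (f F h : R -> R) (a b c s r rho phi x : R).
Local Notation mu := (@lebesgue_measure R).

Lemma subr_mulcos_gt0 c r phi : 0 < r < c -> 0 < c - r * cos phi.
Proof.
move=> /andP[r0 rc]; rewrite subr_gt0 (le_lt_trans _ rc) //.
by rewrite -[leRHS]mulr1 ler_pM2l // cos_le1.
Qed.

(* Unlike the half-angle substitution, [phi + 2 atan (rho sin phi / (1 - rho cos
   phi))] is an antiderivative of the Poisson kernel without jump at [pi]; [rho] is the
   root of [r rho^2 - 2 c rho + r] in the unit disk. *)
Lemma is_derive_poisson c r e : 0 < r < c -> 0 < e -> e ^+ 2 = c ^+ 2 - r ^+ 2 ->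
  let rho := (c - e) / r in
  let F phi := c * phi + r * sin phi
     - e * (phi + 2 * atan (rho * sin phi / (1 - rho * cos phi))) in
  forall phi, is_derive phi 1 F ((r * sin phi) ^+ 2 / (c - r * cos phi)).
Proof.
move=> rc e0 eE rho F phi.
have /andP[r0 rltc] := rc.
have c0 : 0 < c by apply: lt_trans rltc.
have ec : e < c.
  by rewrite -(@ltr_pXn2r _ 2) ?nnegrE ?ltW // eE ltrBlDr ltrDl exprn_gt0.
have rho0 : 0 < rho by rewrite divr_gt0 // subr_gt0.
have rho1 : rho < 1.
  rewrite ltr_pdivrMr // mul1r ltrBlDr.
  rewrite -(@ltr_pXn2r _ 2) ?nnegrE ?addr_ge0 ?(ltW r0) ?(ltW e0) ?(ltW c0) //.
  rewrite sqrrD eE; have := mulr_gt0 r0 e0; lra.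
have den0 : 1 - rho * cos phi != 0.
  rewrite gt_eqF // subr_gt0 (le_lt_trans _ rho1) // -[leRHS]mulr1.
  by rewrite ler_pM2l // cos_le1.
have cr0 : c - r * cos phi != 0 by rewrite gt_eqF // subr_mulcos_gt0.
have rn0 : r != 0 by rewrite gt_eqF.
have dinv : is_derive phi 1 (fun x : R => (1 - rho * cos x)^-1)
    (- (1 - rho * cos phi) ^- 2 *: (rho * sin phi)).
  apply: is_deriveV => //.
  by apply: is_derive_eq; rewrite /GRing.scale /=; ring.
have du : is_derive phi 1 (fun x : R => rho * sin x / (1 - rho * cos x))
    ((rho * cos phi - rho ^+ 2) / (1 - rho * cos phi) ^+ 2).
  apply: is_derive_eq; rewrite /GRing.scale /=.
  have s2 : sin phi * sin phi = 1 - cos phi ^+ 2 by rewrite -expr2 sin2cos2.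
  transitivity ((rho * cos phi * (1 - rho * cos phi) - rho ^+ 2 * (sin phi * sin phi))
     / (1 - rho * cos phi) ^+ 2); first by field.
  by rewrite s2; field.
have datan : is_derive phi 1 (fun x : R => atan (rho * sin x / (1 - rho * cos x)))
    ((1 + (rho * sin phi / (1 - rho * cos phi)) ^+ 2)^-1 *
     ((rho * cos phi - rho ^+ 2) / (1 - rho * cos phi) ^+ 2)).
  exact: (@is_derive1_comp _ atan _ _ _ _ (is_derive1_atan _) du).
(* The numerator is the Poisson denominator 1 - 2 rho cos phi + rho^2, which the quadratic equation
   of [rho] makes proportional to c - r cos phi. *)
have D1 : 1 + (rho * sin phi / (1 - rho * cos phi)) ^+ 2
    = (rho * (2 * (c - r * cos phi)) / r) / (1 - rho * cos phi) ^+ 2.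
  have s2 : sin phi ^+ 2 = 1 - cos phi ^+ 2 by rewrite sin2cos2.
  rewrite expr_div_n exprMn s2.
  have rr : rho ^+ 2 = 2 * c * rho / r - 1.
    rewrite /rho.
    apply: (@mulIf _ (r ^+ 2)); first by rewrite expf_neq0.
    have -> : ((c - e) / r) ^+ 2 * r ^+ 2 = c ^+ 2 - 2 * c * e + e ^+ 2 by field.
    by rewrite eE; field.
  transitivity ((1 - 2 * rho * cos phi + rho ^+ 2) / (1 - rho * cos phi) ^+ 2);
    first by field.
  by rewrite rr; field; rewrite rn0 den0.
apply: is_derive_eq; rewrite /GRing.scale /= D1 [(r * sin phi) ^+ 2]exprMn sin2cos2.
have rhon0 : rho != 0 by rewrite gt_eqF.
transitivity (c + r * cos phi - e * (1 + r * (cos phi - rho) / (c - r * cos phi))).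
  by field; rewrite rn0 rhon0 cr0 den0.
have rrho : r * (cos phi - rho) = r * cos phi - (c - e) by rewrite /rho; field.
rewrite rrho.
(* Polynomial division: r^2 sin^2 phi = (c^2 - r^2 cos^2 phi) - e^2. *)
transitivity (c + r * cos phi - e ^+ 2 / (c - r * cos phi)); first by field.
by rewrite eE; field.
Qed.

(** Here c lies strictly to the right of the support. The sine and arctangent terms of the
    antiderivative vanish at 0 and [pi], so only its linear part counts. *)
Lemma integral_wigner_cauchy s r c : 0 < r -> r < c - s ->
  (\int[mu]_(x in `[(s - r)%R, (s + r)%R]) (wigner s r x / (c - x))%:E =
   (pi * (c - s - Num.sqrt ((c - s) ^+ 2 - r ^+ 2)))%:E)%E.
Proof.
move=> r0 rc.
have c0 : 0 < c - s by apply: lt_trans rc.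
have d0 : 0 < (c - s) ^+ 2 - r ^+ 2.
  by rewrite subr_gt0 ltr_pXn2r // nnegrE ltW.
set e := Num.sqrt _; have e0 : 0 < e by rewrite sqrtr_gt0.
have eE : e ^+ 2 = (c - s) ^+ 2 - r ^+ 2 by rewrite sqr_sqrtr ?ltW.
have rc' : 0 < r < c - s by rewrite r0.
transitivity (\int[mu]_(x in `[(s - r)%R, (s + r)%R])
    ((c - x)^-1 * wigner s r x)%:E)%E.
  by apply: eq_integral => x _; rewrite mulrC.
rewrite (@integral_wigner_cos _ s r (fun x => (c - x)^-1)) //; last first.
  apply: (@continuous_in_subspaceT _ _ _ (fun x : R => (c - x)^-1)) => x.
  rewrite inE /= in_itv /= => /andP[_ xs].
  apply: cvgV; first by rewrite gt_eqF // subr_gt0 (le_lt_trans xs) //; lra.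
  by apply: cvgB; [exact: cvg_cst|exact: cvg_id].
have dF := is_derive_poisson _ _ _ rc' e0 eE.
have cf : continuous (fun phi : R => (r * sin phi) ^+ 2 / (c - s - r * cos phi)).
  move=> x; apply: cvgM.
    apply: (@continuous_comp _ _ _ (fun x => r * sin x) (fun y => y ^+ 2)).
      by apply: cvgM; [exact: cvg_cst|exact: continuous_sin].
    exact: exprn_continuous.
  apply: cvgV; first by rewrite gt_eqF // subr_mulcos_gt0.
  by apply: cvgB; [exact: cvg_cst|apply: cvgM; [exact: cvg_cst|exact: continuous_cos]].
under eq_integral => phi _ do rewrite mulrC opprD addrA.
rewrite (integral_is_derive _ _ _ _ _ (pi_gt0 R) cf dF); congr (_%:E).
by rewrite sinpi sin0 !mulr0 !mul0r atan0; ring.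
Qed.

Lemma measurable_cauchy s r c : r <= c - s ->
  measurable_fun `[s - r, s + r] (fun x => wigner s r x / (c - x)).
Proof.
(* The flags select the open interval, where the denominator stays positive even if r = c - s. *)
move=> rc; apply: (@measurable_fun_itv_cc _ _ _ false true).
apply: open_continuous_measurable_fun; first exact: interval_open.
move=> x; rewrite inE /= in_itv /= => /andP[_ xs].
apply: cvgM; first exact: continuous_wigner.
apply: cvgV; first by rewrite gt_eqF // subr_gt0 (lt_le_trans xs) //; lra.
by apply: cvgB; [exact: cvg_cst|exact: cvg_id].
Qed.

(* When [r = c - s] the integrand is unbounded at the edge; monotone convergence
   in [c + 1/n] reaches this case. *)
Lemma integral_wigner_cauchy_edge s r c : 0 < r -> r <= c - s ->
  (\int[mu]_(x in `[(s - r)%R, (s + r)%R]) (wigner s r x / (c - x))%:E =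
   (pi * (c - s - Num.sqrt ((c - s) ^+ 2 - r ^+ 2)))%:E)%E.
Proof.
move=> r0 rc.
pose cn (n : nat) : R := c + n.+1%:R^-1.
pose g n x : \bar R := (wigner s r x / (cn n - x))%:E.
have cn_gt n : c < cn n by rewrite ltrDl invr_gt0 ltr0n.
have xs x : x \in `[s - r, s + r]%R -> x <= c by rewrite in_itv /= => /andP[_]; lra.
have cnc : cn n @[n --> \oo] --> c.
  rewrite -[X in _ --> X]addr0; apply: cvgD; first exact: cvg_cst.
  exact: cvg_harmonic.
have lim_g x : x \in `[s - r, s + r]%R -> limn (g^~ x) = (wigner s r x / (c - x))%:E.
  move=> xI; apply/cvg_lim => //; apply: cvg_EFin; first exact: nearW.
  have [cx|cx] := eqVneq c x.
    (* If x = c, then x is the right edge s + r, where the profile is 0; the sequence and its limit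
       are then both 0, with division by 0 doing no harm. *)
    have -> : (fine \o g^~ x) = cst (wigner s r x / (c - x)).
      apply/funext => n; rewrite /g /=.
      have -> : wigner s r x = 0; last by rewrite !mul0r.
      have -> : x = s + r by have := xI; rewrite in_itv /=; lra.
      by rewrite /wigner subrr mul0r sqrtr0.
    exact: cvg_cst.
  apply: cvgM; first exact: cvg_cst.
  apply: cvgV; first by rewrite subr_eq0.
  by apply: cvgB => //; exact: cvg_cst.
have int_g n : (\int[mu]_(x in `[(s - r)%R, (s + r)%R]) g n x =
    (pi * (cn n - s - Num.sqrt ((cn n - s) ^+ 2 - r ^+ 2)))%:E)%E.
  by apply: integral_wigner_cauchy => //; have := cn_gt n; lra.
have cv1 : (\int[mu]_(x in `[(s - r)%R, (s + r)%R]) g n x)%E @[n --> \oo]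
    --> (\int[mu]_(x in `[(s - r)%R, (s + r)%R]) limn (g^~ x))%E.
  apply: cvg_monotone_convergence => //.
  - move=> n; apply/measurable_EFinP.
    by apply: measurable_cauchy; have := cn_gt n; lra.
  - move=> n x xI; rewrite lee_fin divr_ge0 ?sqrtr_ge0 // subr_ge0.
    by rewrite (le_trans (xs _ xI)) // ltW.
  - move=> x xI m n mn; rewrite lee_fin ler_wpM2l ?sqrtr_ge0 //.
    have xc := xs _ xI.
    rewrite lef_pV2 ?posrE ?subr_gt0 ?(le_lt_trans xc) //.
    by rewrite lerD2r lerD2l lef_pV2 ?posrE // ler_nat.
rewrite -(_ : (\int[mu]_(x in `[(s - r)%R, (s + r)%R]) limn (g^~ x))%E =
              (\int[mu]_(x in `[(s - r)%R, (s + r)%R]) (wigner s r x / (c - x))%:E)%E); last first.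
  by apply: eq_integral => x; rewrite inE => xI; exact: lim_g.
apply/esym/(@cvg_unique _ (@ereal_hausdorff R) _ _ _ _ _ cv1).
rewrite (funext int_g); apply: cvg_EFin; first exact: nearW.
have cns : cn n - s @[n --> \oo] --> c - s by apply: cvgB => //; exact: cvg_cst.
apply: cvgM; first exact: cvg_cst.
apply: cvgB => //.
apply: (@cvg_comp _ _ _ _ Num.sqrt); last exact: sqrt_continuous.
apply: cvgB; last exact: cvg_cst.
apply: (@cvg_comp _ _ _ _ (fun y => y ^+ 2)); first exact: cns.
exact: exprn_continuous.
Qed.

End CauchyTransform.

(** * Moments of the MANOVA law and their Dickson values *)

Section Manova.
Variable R : realType.
Local Notation mu := (@lebesgue_measure R).
Variables (a b : R).
Hypotheses (ha : 0 < a < 1) (hb : 0 < b < 1).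

Let s : R := a + b - 2 * a * b.
Let rho : R := Num.sqrt (a * (1 - b)) * Num.sqrt (b * (1 - a)).
Let r : R := 2 * rho.
Let I : set R := `[s - r, s + r]%classic.
Let atom : R := Num.max (a + b - 1) 0.

Let a0 : 0 < a. Proof. by case/andP: ha. Qed.
Let a1 : a < 1. Proof. by case/andP: ha. Qed.
Let b0 : 0 < b. Proof. by case/andP: hb. Qed.
Let b1 : b < 1. Proof. by case/andP: hb. Qed.
Let pp : 0 < a * (1 - b). Proof. by rewrite mulr_gt0 ?subr_gt0. Qed.
Let qq : 0 < b * (1 - a). Proof. by rewrite mulr_gt0 ?subr_gt0. Qed.

Lemma manova_rho_gt0 : 0 < rho.
Proof. by rewrite mulr_gt0 ?sqrtr_gt0. Qed.

Lemma manova_rho_sq : rho ^+ 2 = a * b * (1 - a) * (1 - b).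
Proof. by rewrite exprMn !sqr_sqrtr ?ltW //; ring. Qed.

Lemma manova_rmE : manova_rm a b = s - r.
Proof. by rewrite /manova_rm sqrrB !sqr_sqrtr ?ltW // /s /r /rho; ring. Qed.

Lemma manova_rpE : manova_rp a b = s + r.
Proof. by rewrite /manova_rp sqrrD !sqr_sqrtr ?ltW // /s /r /rho; ring. Qed.

Let r0 : 0 < r. Proof. by rewrite mulr_gt0 // manova_rho_gt0. Qed.

(** This perfect square makes the Cauchy transform at 1 explicit; it vanishes for a + b = 1, when
    the support reaches 1. *)
Lemma manova_gap_sq : (1 - s) ^+ 2 - r ^+ 2 = (1 - a - b) ^+ 2.
Proof. by rewrite /r exprMn manova_rho_sq /s; ring. Qed.

Lemma manova_edge_le : r <= 1 - s.
Proof.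
have s1 : 0 <= 1 - s.
  have -> : 1 - s = (1 - a) * (1 - b) + a * b by rewrite /s; ring.
  by rewrite addr_ge0 // mulr_ge0 // ?subr_ge0 ltW.
rewrite -(@ler_pXn2r _ 2) ?nnegrE ?(ltW r0) // -subr_ge0 manova_gap_sq.
exact: sqr_ge0.
Qed.

Lemma manova_rm_ge0 : 0 <= s - r.
Proof. by rewrite -manova_rmE sqr_ge0. Qed.

Let cauchy x := wigner s r x / (1 - x).

Let mI : measurable I. Proof. exact: measurable_itv. Qed.

Lemma support_bounds x : I x -> 0 <= x <= 1 /\ x <= s + r.
Proof.
rewrite /I /= in_itv /= => /andP[x1 x2].
by have := manova_rm_ge0; have := manova_edge_le; split; [lra|].
Qed.

Lemma cauchy_ge0 x : I x -> 0 <= cauchy x.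
Proof.
move=> /support_bounds[x01 _]; rewrite divr_ge0 ?sqrtr_ge0 //; lra.
Qed.

Lemma integral_cauchy : (\int[mu]_(x in I) (cauchy x)%:E =
  (pi * (1 - s - `|1 - a - b|))%:E)%E.
Proof.
by rewrite integral_wigner_cauchy_edge ?manova_edge_le // manova_gap_sq sqrtr_sqr.
Qed.

Lemma integrable_cauchy : mu.-integrable I (EFin \o cauchy).
Proof.
apply/integrableP; split.
  by apply/measurable_EFinP; apply: measurable_cauchy; exact: manova_edge_le.
rewrite (_ : (\int[mu]_(x in I) _)%E = (\int[mu]_(x in I) (cauchy x)%:E)%E).
  by rewrite integral_cauchy ltry.
by apply: eq_integral => x; rewrite inE => xI; rewrite /= ger0_norm // cauchy_ge0.
Qed.

(** The integrand of the moment of order n.+1: one power of x has been cancelled against the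
    denominator of the density. *)
Let m n x := x ^+ n / (2 * pi) * cauchy x.

Lemma integrable_moment n : mu.-integrable I (EFin \o m n).
Proof.
have mx : measurable_fun I (fun x : R => x ^+ n / (2 * pi)).
  by apply: measurable_funTS; apply: continuous_measurable_fun; exact: continuous_expn_div.
have bx : [bounded (x : R) ^+ n / (2 * pi) | x in I].
  exists ((2 * pi)^-1); split; first exact: num_real.
  move=> M hM x /support_bounds[/andP[x0 x1] _] /=.
  rewrite (le_trans _ (ltW hM)) // normrM ger0_norm ?exprn_ge0 //.
  have p0 : 0 < (2 * pi)^-1 :> R by rewrite invr_gt0 mulr_gt0 ?pi_gt0.
  by rewrite gtr0_norm // ler_piMl ?exprn_ile1 // ltW.
by have := @integrableMr _ _ R mu I mI _ _ mx bx integrable_cauchy; apply: eq_integrable.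
Qed.

Lemma manova_momentE n : manova_moment a b n.+1 =
  ((\int[mu]_(x in I) m n x)%R + atom)%:E.
Proof.
rewrite /manova_moment manova_rmE manova_rpE.
have -> : (1 - Num.min a b) * 0 ^+ n.+1 + Num.max (a + b - 1) 0 * 1 ^+ n.+1 = atom.
  by rewrite expr0n /= mulr0 add0r expr1n mulr1.
rewrite EFinD; congr (_ + _)%E.
rewrite /Rintegral fineK; last by have := @integrable_fin_num _ _ R mu I mI _ (integrable_moment n).
apply: eq_integral => x; rewrite inE => xI; congr (_%:E).
rewrite /m /cauchy /manova_density manova_rmE manova_rpE -/(wigner s r x).
(* The cancellation of x needs x != 0; a support point x = 0 is the left edge, where the profile is
   0. *)
have [x0|x0] := eqVneq x 0.
  have -> : wigner s r x = 0; last by rewrite !(mul0r, mulr0).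
  have [_ xs] := support_bounds _ xI.
  have srx : s - r = x.
    by have := manova_rm_ge0; move: xI; rewrite /I /= in_itv /= x0; lra.
  by rewrite /wigner srx subrr mulr0 sqrtr0.
rewrite exprS [2 * pi * x * _]mulrC -!mulrA !invfM.
move: (x ^+ n) (wigner s r x) ((1 - x)^-1) (pi^-1) => X W V P.
by field.
Qed.

Lemma manova_moment_fin n : manova_moment a b n.+1 \is a fin_num.
Proof. by rewrite manova_momentE. Qed.

Lemma manova_moment_diff n :
  fine (manova_moment a b n.+1) - fine (manova_moment a b n.+2) =
  semicircle_moment R s r n.
Proof.
rewrite !manova_momentE /= opprD addrACA subrr addr0 -RintegralB //;
  try exact: integrable_moment.
rewrite /semicircle_moment; apply: eq_Rintegral => x; rewrite inE => xI.
(* Likewise, a support point x = 1 is the right edge, so the failing cancellation of 1 - x is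
   harmless. *)
rewrite /m /cauchy; have [x1|x1] := eqVneq x 1.
  have -> : wigner s r x = 0; last by rewrite !(mul0r, mulr0) subrr.
  have [_ xs] := support_bounds _ xI.
  have -> : x = s + r by have := manova_edge_le; lra.
  by rewrite /wigner subrr mul0r sqrtr0.
rewrite exprS; move: (x ^+ n) (wigner s r x) (2 * pi)^-1 => X W V.
by field; rewrite subr_eq0 eq_sym.
Qed.

(** The absolute value left by the Cauchy transform at 1 is compensated by the atom when a + b > 1,
    so both signs give the same value. *)
Lemma manova_moment1 : fine (manova_moment a b 1) = a * b.
Proof.
rewrite manova_momentE /= /Rintegral.
rewrite (_ : (\int[mu]_(x in I) _)%E = ((2 * pi)^-1%:E * \int[mu]_(x in I) (cauchy x)%:E)%E); last first.
  rewrite -integralZl //; last exact: integrable_cauchy.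
  by apply: eq_integral => x _; rewrite /m expr0 div1r EFinM.
rewrite integral_cauchy /= /atom.
have -> : (2 * pi)^-1 * (pi * (1 - s - `|1 - a - b|)) = (1 - s - `|1 - a - b|) / 2.
  have pi0 : pi != 0 :> R by rewrite gt_eqF ?pi_gt0.
  by move: (pi : R) pi0 => q q0; field.
case: (leP (a + b - 1) 0) => h; [rewrite ger0_norm|rewrite ltr0_norm]; try lra; by rewrite /s; field.
Qed.

(* The value at 0 is not the total mass of the law: it is the limit of the
   zeroth term [E (tr A + tr B) / 2] of the sequence fed to [dickson]. *)
Definition manova_seq n : R :=
  if n is 0%N then (a + b) / 2 else fine (manova_moment a b n).

(** The semicircle values of t_k are the MANOVA values of (x - x^2) t_k. Expanding x^2 t_k gives a
    recurrence in k for the values of x t_k, started by the first moment. *)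
Lemma dickson_manova1 k : dickson s (rho ^+ 2) manova_seq k 1 =
  - (1 - a - b) * (a * b) ^+ k + (k == 1%N)%:R * rho ^+ 2
   + (k == 0%N)%:R * (1 - a - b + 2 * a * b).
Proof.
set v := dickson s (rho ^+ 2) manova_seq.
have rec j : v j 1%N - v j 2%N = (j == 0%N)%:R * (2 * rho ^+ 2) - (j == 2%N)%:R * rho ^+ 4.
  rewrite -(dickson_semicircle R s) ?manova_rho_gt0 // /v.
  have -> : dickson s (rho ^+ 2) manova_seq j 1 =
      dickson s (rho ^+ 2) (fun i => manova_seq i.+1) j 0 by rewrite dickson_shift.
  have -> : dickson s (rho ^+ 2) manova_seq j 2 =
      dickson s (rho ^+ 2) (fun i => manova_seq i.+2) j 0.
    by rewrite (dickson_shift _ _ _ (fun i => manova_seq i.+1)) dickson_shift.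
  rewrite -dicksonB; apply: eq_dickson => n; exact: manova_moment_diff.
have v0 : v 0%N 1%N = 2 * a * b by rewrite /v /= manova_moment1; ring.
elim/nat_ind2: k => [||k IH0 IH1].
- by rewrite v0 /=; ring.
- have := rec 0%N; rewrite {2}/v dickson0_shift -/v v0 /= => E.
  have -> : v 1%N 1%N = (2 * a * b - s * (2 * a * b) -
     (2 * a * b - (v 1%N 1%N *+ 2 + s * (2 * a * b)))) / 2 by field.
  by rewrite E manova_rho_sq /s; field.
- have := rec k.+1; rewrite {2}/v dicksonS_shift -/v IH0 IH1 => E.
  have D4 : rho ^+ 4 = rho ^+ 2 * rho ^+ 2 by rewrite -exprD.
  move: E; rewrite D4 manova_rho_sq; set w := v k.+2 1%N.
  set x := (X in X - _ = _); set y := (X in x - (_ + _ + X) = _) => E.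
  have -> : w = x - s * x - y - (x - (w + s * x + y)) by ring.
  rewrite E /x /y /s !exprS.
  by case: k {IH0 IH1 w x y E} => [|[|k]] /=; rewrite ?expr0 ?exprS; ring.
Qed.

Let z1 : R := - b * (1 - a).
Let z2 : R := - a * (1 - b).

(** The values of x t_k are the source term of a recurrence for those of t_k, with homogeneous roots
    [z1] and [z2]. The result is what [rtr_word] forces when the word traces are 1 for k = 0 and 0
    afterwards. *)
Lemma dickson_manova k : dickson s (rho ^+ 2) manova_seq k 0 =
  - (1 - a - b) * (a * b) ^+ k - (a - b) / 2 * (z1 ^+ k - z2 ^+ k)
  + (k == 0%N)%:R.
Proof.
elim/nat_ind2: k => [||k IH0 IH1].
- by rewrite /=; field.
- by rewrite /= manova_moment1 /z1 /z2 /s; field.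
- have := dickson_manova1 k.+1; rewrite dicksonS_shift IH0 IH1 manova_rho_sq.
  set w := dickson _ _ _ k.+2 0; set x := (X in _ + s * X + _ = _).
  set y := (X in _ + _ + X = _) => E.
  have -> : w = (w + s * x + y) - s * x - y by ring.
  rewrite E /x /y /s /z1 /z2 !exprS.
  by case: k {IH0 IH1 w x y E} => [|k] /=; rewrite ?expr0 ?exprS; field.
Qed.

End Manova.

(** * From Dickson values to moments in the limit *)

Section Limit.
Variables (R : realType) (a b : R).
Hypotheses (ha : 0 < a < 1) (hb : 0 < b < 1).
Let s : R := a + b - 2 * a * b.
Let D : R := a * b * (1 - a) * (1 - b).
Let z1 : R := - b * (1 - a).
Let z2 : R := - a * (1 - b).

(** The argument runs on the difference [e] of the two moment sequences: its values at t_k tend to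
    0, induction on j extends this to x^j t_k, and t_0 = 2 returns the moments. *)
Lemma moments_cvg_of_dickson (M E : nat -> nat -> R) (EA EB : nat -> R) :
  (forall i k, E i k = dickson s D (M i) k 0 + (1 - EA i - EB i) * (a * b) ^+ k
     + (EA i - EB i) / 2 * (z1 ^+ k - z2 ^+ k)) ->
  EA @ \oo --> a -> EB @ \oo --> b ->
  (forall k, E ^~ k @ \oo --> ((k == 0%N)%:R : R)) ->
  forall n, M ^~ n @ \oo --> manova_seq R a b n.
Proof.
move=> EM cA cB cE n.
pose e i j := M i j - manova_seq R a b j.
have e0 k : (fun i => dickson s D (e i) k 0) @ \oo --> (0 : R).
  have -> : (fun i => dickson s D (e i) k 0) = (fun i => E i k
      - (1 - EA i - EB i) * (a * b) ^+ k - (EA i - EB i) / 2 * (z1 ^+ k - z2 ^+ k)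
      - dickson s D (manova_seq R a b) k 0).
    by apply/funext => i; rewrite EM /e dicksonB; ring.
  have -> : 0 = (k == 0%N)%:R - (1 - a - b) * (a * b) ^+ k
      - (a - b) / 2 * (z1 ^+ k - z2 ^+ k) - dickson s D (manova_seq R a b) k 0.
    by rewrite /s /D -manova_rho_sq // dickson_manova //; rewrite /z1 /z2; ring.
  apply: cvgB; last exact: cvg_cst.
  apply: cvgB.
    apply: cvgB; first exact: cE.
    apply: cvgM; last exact: cvg_cst.
    by apply: cvgB => //; apply: cvgB => //; exact: cvg_cst.
  apply: cvgM; last exact: cvg_cst.
  by apply: cvgM; [exact: cvgB|exact: cvg_cst].
have en k j : (fun i => dickson s D (e i) k j) @ \oo --> (0 : R).
  elim: j k => [//|j IH] [|k].
    have -> : (fun i => dickson s D (e i) 0 j.+1) =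
        (fun i => dickson s D (e i) 1 j + dickson s D (e i) 1 j + s * dickson s D (e i) 0 j).
      by apply/funext => i; rewrite dickson0_shift mulr2n.
    have := cvgD (cvgD (IH 1%N) (IH 1%N)) (cvgM (cvg_cst s) (IH 0%N)).
    by rewrite mulr0 !addr0; apply.
  have -> : (fun i => dickson s D (e i) k.+1 j.+1) = (fun i =>
      dickson s D (e i) k.+2 j + s * dickson s D (e i) k.+1 j + D * dickson s D (e i) k j).
    by apply/funext => i; rewrite dicksonS_shift.
  have := cvgD (cvgD (IH k.+2) (cvgM (cvg_cst s) (IH k.+1)))
    (cvgM (cvg_cst D) (IH k)).
  by rewrite !mulr0 !addr0; apply.
have -> : M ^~ n = (fun i => dickson s D (e i) 0 n / 2 + manova_seq R a b n).
  by apply/funext => i; rewrite /= /e; field.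
have := cvgD (cvgM (en 0%N n) (cvg_cst (2^-1 : R))) (cvg_cst (manova_seq R a b n)).
by rewrite mul0r add0r; apply.
Qed.

End Limit.

(** * Spectral moments as traces of powers *)

Section EsdMoment.
Variable R : realType.

Lemma char_poly_conj (C : comUnitRingType) n (P M : 'M[C]_n) : P \in unitmx ->
  char_poly (invmx P *m M *m P) = char_poly M.
Proof.
move=> Pu; rewrite /char_poly.
pose Pi := map_mx polyC (invmx P); pose Pp := map_mx polyC P.
have PiP : Pi *m Pp = 1%:M by rewrite -map_mxM mulVmx // map_mx1.
have -> : char_poly_mx (invmx P *m M *m P) = Pi *m char_poly_mx M *m Pp.
  rewrite /char_poly_mx !map_mxM mulmxBr mulmxBl; congr (_ - _).
  by rewrite mul_mx_scalar -scalemxAl PiP scalemx1.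
rewrite !det_mulmx mulrAC -det_mulmx PiP det1 mul1r //.
Qed.

Lemma diag_mx_exp (C : comNzRingType) n (d : 'rV[C]_n) k :
  (diag_mx d : 'M[C]_n) ^+ k = diag_mx (map_mx (fun x => x ^+ k) d).
Proof.
elim: k => [|k IH].
  by apply/matrixP => i j; rewrite expr0 !mxE.
rewrite exprS IH -mulmxE mul_diag_mx; apply/matrixP => i j.
by rewrite !mxE mulrnAr exprS.
Qed.

Lemma conj_mx_exp (C : comUnitRingType) n (P M : 'M[C]_n) k : P \in unitmx ->
  (invmx P *m M *m P) ^+ k = invmx P *m (M ^+ k) *m P.
Proof.
move=> Pu; elim: k => [|k IH].
  by rewrite !expr0 mulmx1 mulVmx.
by rewrite !exprS IH -!mulmxE !mulmxA mulmxK.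
Qed.

Lemma esd_moment_rtr n (M : 'M[R[i]]_n) k : adjmx M = M ->
  esd_moment M k = rtr R n (M ^+ k).
Proof.
move=> Mh.
have hM : M \is hermsymmx.
  by apply/is_hermitianmxP; rewrite expr0 scale1r -[LHS]Mh.
have /orthomx_spectralP ME := hermitian_normalmx hM.
set P := spectralmx M in ME; set d := spectral_diag M in ME.
have Pu : P \in unitmx := spectral_unit M.
have dreal i : ((complex.Re (d 0 i))%:C)%C = d 0 i.
  apply: RRe_real; exact: (mxOverP (hermitian_spectral_diag_real hM)).
(* Both lists split the same characteristic polynomial into linear factors, so they agree up to
   order. *)
have eigE : perm_eq (eigenvalues M) [seq d 0 i | i <- enum 'I_n].
  apply: prod_XsubC_eq; rewrite /eigenvalues.
  case: closed_field_poly_normal => /= r; rewrite (monicP (char_poly_monic M)) scale1r.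
  move=> <-; rewrite ME char_poly_conj // char_poly_trig ?diag_mx_is_trig //.
  by rewrite big_map big_enum /=; apply: eq_bigr => i _; rewrite mxE eqxx mulr1n.
rewrite /esd_moment (perm_big _ eigE) big_map big_enum /= /rtr /ntr.
rewrite ME conj_mx_exp // diag_mx_exp mxtrace_mulC mulmxA mulmxV // mul1mx mxtrace_diag.
have -> : \sum_i (map_mx (fun x : R[i] => x ^+ k) d) 0 i
   = ((\sum_i (complex.Re (d 0 i)) ^+ k)%:C)%C.
  rewrite rmorph_sum; apply: eq_bigr => i _.
  by rewrite mxE rmorphXn /= dreal.
have -> : (n%:R^-1 : R[i]) = ((n%:R^-1)%:C)%C by rewrite fmorphV rmorph_nat.
by rewrite -rmorphM.
Qed.

End EsdMoment.

(** * Bounded measurable functions and random matrices *)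

Section BoundedMeasurable.
Context (d : measure_display) (T : measurableType d) (R : realType).

(** Boundedness makes the class stable under products, unlike integrability, and integrable for
    every probability. *)
Definition bmeas (f : T -> R) :=
  measurable_fun setT f /\ exists C, forall w, `|f w| <= C.

Lemma bmeas_cst c : bmeas (fun _ => c).
Proof. by split; [exact: measurable_cst|exists `|c|]. Qed.

Lemma bmeasD f g : bmeas f -> bmeas g -> bmeas (fun w => f w + g w).
Proof.
move=> [mf [C fC]] [mg [C' gC]]; split; first exact: measurable_funD.
by exists (C + C') => w; rewrite (le_trans (ler_normD _ _)) // lerD.
Qed.

Lemma bmeasM f g : bmeas f -> bmeas g -> bmeas (fun w => f w * g w).
Proof.
move=> [mf [C fC]] [mg [C' gC]]; split; first exact: measurable_funM.
by exists (C * C') => w; rewrite normrM ler_pM.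
Qed.

Lemma bmeasB f g : bmeas f -> bmeas g -> bmeas (fun w => f w - g w).
Proof.
move=> bf bg; have := bmeasD _ _ bf (bmeasM _ _ (bmeas_cst (-1)) bg).
by congr bmeas; apply/funext => w; rewrite mulN1r.
Qed.

Lemma bmeas_integrable (P : probability T R) f :
  bmeas f -> P.-integrable setT (EFin \o f).
Proof.
move=> [mf [C fC]]; apply: measurable_bounded_integrable => //.
  exact: (le_lt_trans (probability_le1 P (@measurableT _ T)) (ltry 1)).
by exists C; split; [exact: num_real|move=> M CM w _; rewrite /= (le_trans (fC w)) // ltW].
Qed.

Definition bmeasc (f : T -> R[i]) :=
  bmeas (fun w => complex.Re (f w)) /\ bmeas (fun w => complex.Im (f w)).

Lemma bmeasc_cst c : bmeasc (fun _ => c).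
Proof. by split; exact: bmeas_cst. Qed.

Lemma bmeascD f g : bmeasc f -> bmeasc g -> bmeasc (fun w => f w + g w).
Proof.
move=> [f1 f2] [g1 g2]; split.
  have := bmeasD _ _ f1 g1; congr bmeas.
  by apply/funext => w; case: (f w) (g w) => [x y] [u v].
have := bmeasD _ _ f2 g2; congr bmeas.
by apply/funext => w; case: (f w) (g w) => [x y] [u v].
Qed.

Lemma bmeascM f g : bmeasc f -> bmeasc g -> bmeasc (fun w => f w * g w).
Proof.
move=> [f1 f2] [g1 g2]; split.
  have := bmeasB _ _ (bmeasM _ _ f1 g1) (bmeasM _ _ f2 g2); congr bmeas.
  by apply/funext => w; case: (f w) (g w) => [x y] [u v].
have := bmeasD _ _ (bmeasM _ _ f1 g2) (bmeasM _ _ f2 g1); congr bmeas.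
by apply/funext => w; case: (f w) (g w) => [x y] [u v].
Qed.

Lemma bmeasc_sum (I : Type) (l : seq I) (f : I -> T -> R[i]) :
  (forall i, bmeasc (f i)) -> bmeasc (fun w => \sum_(i <- l) f i w).
Proof.
move=> bf; elim: l => [|i l IH].
  by under eq_fun do rewrite big_nil; exact: bmeasc_cst.
by under eq_fun do rewrite big_cons; exact: bmeascD.
Qed.

Definition bmeasmx n (F : T -> 'M[R[i]]_n) := forall j l, bmeasc (fun w => F w j l).

Lemma bmeasmxM n (F G : T -> 'M[R[i]]_n) :
  bmeasmx n F -> bmeasmx n G -> bmeasmx n (fun w => F w * G w).
Proof.
move=> bF bG j l; under eq_fun do rewrite -mulmxE mxE.
by apply: bmeasc_sum => k; exact: bmeascM.
Qed.

Lemma bmeasmxX n (F : T -> 'M[R[i]]_n) k :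
  bmeasmx n F -> bmeasmx n (fun w => F w ^+ k).
Proof.
move=> bF; elim: k => [|k IH].
  by move=> j l; under eq_fun do rewrite expr0; exact: bmeasc_cst.
by under eq_fun do rewrite exprS; exact: bmeasmxM.
Qed.

Lemma bmeas_rtr n (F : T -> 'M[R[i]]_n) :
  bmeasmx n F -> bmeas (fun w => rtr R n (F w)).
Proof.
move=> bF.
by case: (bmeascM _ _ (bmeasc_cst (n%:R^-1))
  (bmeasc_sum _ (index_enum _) _ (fun i : 'I_n => bF i i))).
Qed.

End BoundedMeasurable.

(** * Entry bounds for orthogonal projections *)

Section Projections.
Variables (R : realType) (n : nat).
Implicit Types M A B : 'M[R[i]]_n.

Lemma adjmxM A B : adjmx (A *m B) = adjmx B *m adjmx A.
Proof. by rewrite /adjmx trmx_mul (map_mxM (@conjc R)). Qed.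

(* The (j, j) entry of [A = A A^*] is the squared norm of the j-th row of A. *)
Lemma proj_entry A j l : is_orth_proj A ->
  `|complex.Re (A j l)| <= 1 /\ `|complex.Im (A j l)| <= 1.
Proof.
have aux1 (x y : R) : x ^+ 2 + y ^+ 2 <= x -> x <= 1.
  have := sqr_ge0 y; move: (y ^+ 2) => z z0 xz.
  by rewrite leNgt; apply/negP => x1; nra.
have aux2 (x y t : R) : x ^+ 2 + y ^+ 2 <= t -> t <= 1 -> `|x| <= 1 /\ `|y| <= 1.
  have := sqr_ge0 x; have := sqr_ge0 y => y0 x0 xyt t1.
  by split; rewrite -(@ler_pXn2r _ 2) ?nnegrE // expr1n real_normK ?num_real //; lra.
move=> [AA Ah].
have rowE : complex.Re (A j j) =
    \sum_k (complex.Re (A j k) ^+ 2 + complex.Im (A j k) ^+ 2).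
  rewrite -[in LHS]AA mxE raddf_sum; apply: eq_bigr => k _.
  by rewrite -[in X in _ * X]Ah !mxE; case: (A j k) => x y /=; ring.
have le_row k : complex.Re (A j k) ^+ 2 + complex.Im (A j k) ^+ 2 <= complex.Re (A j j).
  rewrite rowE (bigD1 k) //= lerDl sumr_ge0 // => i _.
  by rewrite addr_ge0 // sqr_ge0.
(* The diagonal entry dominates its own squared modulus, hence is at most 1; it then bounds the rest
   of its row. *)
exact: (aux2 _ _ _ (le_row l) (aux1 _ _ (le_row j))).
Qed.

End Projections.

(** * Expected traces of words in the random projections *)

Section ExpectedWords.
Context (d : measure_display) (T : measurableType d) (R : realType).
Variables (P : probability T R) (n : nat) (A B : T -> 'M[R[i]]_n) (a b : R).
Hypotheses (n0 : (0 < n)%N).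
Hypotheses (pA : forall w, is_orth_proj (A w)) (pB : forall w, is_orth_proj (B w)).
Hypotheses (mA : bmeasmx d T R n A) (mB : bmeasmx d T R n B).

Definition moment_fun j w : R :=
  if j is 0%N then (rtr R n (A w) + rtr R n (B w)) / 2
  else rtr R n ((A w * B w * A w) ^+ j).

Lemma integrable_moment_fun j : P.-integrable setT (EFin \o moment_fun j).
Proof.
apply: bmeas_integrable; case: j => [|j] /=.
  by apply: bmeasM; [apply: bmeasD; exact: bmeas_rtr|exact: bmeas_cst].
by apply: bmeas_rtr; apply: bmeasmxX; apply: bmeasmxM => //; exact: bmeasmxM.
Qed.

Lemma expectation_Rintegral (f : T -> R) : P.-integrable setT (EFin \o f) ->
  ('E_P[f] = (\int[P]_w f w)%R%:E)%E.
Proof. by move=> fi; rewrite unlock /Rintegral fineK //; exact: integrable_fin_num. Qed.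

Lemma Rintegral_probability_cst (r : R) : (\int[P]_w r)%R = r.
Proof. by rewrite /Rintegral; have := expectation_cst P r; rewrite unlock => ->. Qed.

Let word w k : R := rtr R n (((A w - ((a%:C)%C)%:M) *m (B w - ((b%:C)%C)%:M)) ^+ k).
Let EA : R := (\int[P]_w rtr R n (A w))%R.
Let EB : R := (\int[P]_w rtr R n (B w))%R.

Lemma integral_rtr_word k :
  P.-integrable setT (EFin \o word ^~ k) /\
  (\int[P]_w word w k)%R =
  dickson (a + b - 2 * a * b) (a * b * (1 - a) * (1 - b))
      (fun j => (\int[P]_w moment_fun j w)%R) k 0
  + (1 - EA - EB) * (a * b) ^+ k
  + (EA - EB) / 2 * ((- b * (1 - a)) ^+ k - (- a * (1 - b)) ^+ k).
Proof.
set s := a + b - _; set D := a * b * _ * _; set p := (a * b) ^+ k.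
set z := (X in _ / 2 * X).
have [ti tE] := @dickson_Rintegral _ _ _ P _ measurableT s D moment_fun integrable_moment_fun k 0.
have i1 : P.-integrable setT (EFin \o (fun=> 1 : R)) by apply/bmeas_integrable/bmeas_cst.
have iA : P.-integrable setT (EFin \o (fun w => rtr R n (A w))) by apply/bmeas_integrable/bmeas_rtr.
have iB : P.-integrable setT (EFin \o (fun w => rtr R n (B w))) by apply/bmeas_integrable/bmeas_rtr.
(* The corrections (1 - tA - tB) p + (tA - tB) z / 2 of [rtr_word], with tA and tB the traces, are
   regrouped as p - (p - z / 2) tA - (p + z / 2) tB. *)
have [fi fE] := @integrable_lin3 _ _ _ P _ measurableT _ _ _ (- p) 0 ti i1 i1.
have [gi gE] := @integrable_lin3 _ _ _ P _ measurableT _ _ _ (p - z / 2) (p + z / 2) fi iA iB.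
pose g w := dickson s D (moment_fun ^~ w) k 0 - (- p) * 1 - 0 * 1
    - (p - z / 2) * rtr R n (A w) - (p + z / 2) * rtr R n (B w).
have wE : word ^~ k = g.
  apply/funext => w; have [AA _] := pA w; have [BB _] := pB w.
  have := rtr_word R n (A w) (B w) a b AA BB n0 k 0.
  rewrite expr0 mul1r mul1r -/p -/s -/D -/z /word => ->.
  rewrite (_ : (fun j => _) = moment_fun ^~ w) //.
  by rewrite /g; field.
split; first by rewrite wE; exact: gi.
have -> : (\int[P]_w word w k)%R = (\int[P]_w g w)%R.
  by apply: eq_Rintegral => w _; rewrite -wE.
by rewrite gE fE tE -/EA -/EB Rintegral_probability_cst; field.
Qed.

Lemma esd_moment_fun k w : esd_moment (A w *m B w *m A w) k.+1 = moment_fun k.+1 w.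
Proof.
have [_ hA] := pA w; have [_ hB] := pB w.
by rewrite esd_moment_rtr // !adjmxM hA hB mulmxA.
Qed.

End ExpectedWords.

(** * Convergence in moments to the MANOVA law *)

Theorem theorem1p5 (R : realType) (N : nat -> nat)
  (d : nat -> measure_display) (Omega : forall i, measurableType (d i))
  (P : forall i, probability (Omega i) R)
  (A B : forall i, Omega i -> 'M[R[i]]_(N i)) (alpha beta : R) :
  (forall i, (0 < N i)%N) ->
  {homo N : m n / (m < n)%N} ->
  (forall i w, is_orth_proj (A i w)) ->
  (forall i w, is_orth_proj (B i w)) ->
  (forall i (j l : 'I_(N i)),
     measurable_fun setT (fun w => complex.Re (A i w j l)) /\
     measurable_fun setT (fun w => complex.Im (A i w j l)) /\
     measurable_fun setT (fun w => complex.Re (B i w j l)) /\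
     measurable_fun setT (fun w => complex.Im (B i w j l))) ->
  0 < alpha < 1 -> 0 < beta < 1 ->
  (* (1/N) E Tr(A) - alpha --> 0  (real and imaginary parts) *)
  ((fun i => 'E_(P i)[fun w => complex.Re (ntr (A i w))] - alpha%:E)
     @ \oo --> 0%E)%E ->
  ((fun i => 'E_(P i)[fun w => complex.Im (ntr (A i w))]) @ \oo --> 0%E)%E ->
  ((fun i => 'E_(P i)[fun w => complex.Re (ntr (B i w))] - beta%:E)
     @ \oo --> 0%E)%E ->
  ((fun i => 'E_(P i)[fun w => complex.Im (ntr (B i w))]) @ \oo --> 0%E)%E ->
  (forall k : nat, (1 <= k)%N ->
     ((fun i => 'E_(P i)[fun w => complex.Re (ntr
         (((A i w - (alpha%:C)%C%:M) *m (B i w - (beta%:C)%C%:M)) ^+ k))])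
        @ \oo --> 0%E)%E /\
     ((fun i => 'E_(P i)[fun w => complex.Im (ntr
         (((A i w - (alpha%:C)%C%:M) *m (B i w - (beta%:C)%C%:M)) ^+ k))])
        @ \oo --> 0%E)%E) ->
  forall k : nat, (1 <= k)%N ->
    manova_moment alpha beta k \is a fin_num /\
    ((fun i => 'E_(P i)[fun w => esd_moment (A i w *m B i w *m A i w) k])
       @ \oo --> manova_moment alpha beta k)%E.
Proof.
move=> N0 _ pA pB mAB ha hb cA _ cB _ cE [//|k] _.
have mA i : bmeasmx _ _ _ _ (A i).
  move=> j l; have [m1 [m2 _]] := mAB i j l.
  by split; split=> //; exists 1 => w; case: (proj_entry R _ _ j l (pA i w)).
have mB i : bmeasmx _ _ _ _ (B i).
  move=> j l; have [_ [_ [m1 m2]]] := mAB i j l.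
  by split; split=> //; exists 1 => w; case: (proj_entry R _ _ j l (pB i w)).
have fin : manova_moment alpha beta k.+1 \is a fin_num by exact: manova_moment_fin.
split=> //.
pose EA i := (\int[P i]_w rtr R (N i) (A i w))%R.
pose EB i := (\int[P i]_w rtr R (N i) (B i w))%R.
pose M i j := (\int[P i]_w moment_fun _ _ R _ (A i) (B i) j w)%R.
pose E i k := (\int[P i]_w rtr R (N i) (((A i w - ((alpha%:C)%C)%:M) *m
   (B i w - ((beta%:C)%C)%:M)) ^+ k))%R.
have iM i j := integrable_moment_fun _ _ _ (P i) _ _ _ (mA i) (mB i) j.
have wordP i := integral_rtr_word _ _ _ (P i) _ _ _ alpha beta (N0 i) (pA i) (pB i) (mA i) (mB i).
have cvgEF (u : nat -> R) l : (fun i => (u i)%:E) @ \oo --> l%:E -> u @ \oo --> l.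
  by move=> /fine_cvgP[].
have cvg_sub0 (u : nat -> R) l : (fun i => (u i)%:E - l%:E)%E @ \oo --> 0%E -> u @ \oo --> l.
  move=> /(cvgEF (fun i => u i - l)) h.
  rewrite (_ : u = fun i => u i - l + l); last by apply/funext => i; rewrite subrK.
  by have := cvgD h (cvg_cst l); rewrite add0r; apply.
have iA i : (P i).-integrable setT (EFin \o (fun w => rtr R (N i) (A i w))).
  exact/bmeas_integrable/bmeas_rtr.
have iB i : (P i).-integrable setT (EFin \o (fun w => rtr R (N i) (B i w))).
  exact/bmeas_integrable/bmeas_rtr.
have cEA : EA @ \oo --> alpha.
  apply: cvg_sub0.
  have -> : (fun i => (EA i)%:E - alpha%:E)%E =
      (fun i => 'E_(P i)[fun w => rtr R (N i) (A i w)] - alpha%:E)%E.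
    by apply/funext => i; rewrite expectation_Rintegral.
  exact: cA.
have cEB : EB @ \oo --> beta.
  apply: cvg_sub0.
  have -> : (fun i => (EB i)%:E - beta%:E)%E =
      (fun i => 'E_(P i)[fun w => rtr R (N i) (B i w)] - beta%:E)%E.
    by apply/funext => i; rewrite expectation_Rintegral.
  exact: cB.
have cEE j : E ^~ j @ \oo --> ((j == 0%N)%:R : R).
  case: j => [|j].
    (* The hypotheses on words start at power 1; the power 0 is the identity, of normalized trace 1
       because N i > 0. *)
    have -> : E ^~ 0%N = fun=> 1.
      apply/funext => i; rewrite /E; under eq_Rintegral do rewrite expr0 rtr1 //.
      by rewrite Rintegral_probability_cst.
    exact: cvg_cst.
  apply: cvgEF; have [cj _] := cE j.+1 isT.
  have -> : (fun i => (E i j.+1)%:E) = (fun i => 'E_(P i)[fun w => rtr R (N i)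
      (((A i w - ((alpha%:C)%C)%:M) *m (B i w - ((beta%:C)%C)%:M)) ^+ j.+1)])%E.
    by apply/funext => i; rewrite expectation_Rintegral //; case: (wordP i j.+1).
  exact: cj.
have cM := moments_cvg_of_dickson R alpha beta ha hb M E EA EB
  (fun i j => (wordP i j).2) cEA cEB cEE k.+1.
have -> : (fun i => ('E_(P i)[fun w => esd_moment (A i w *m B i w *m A i w) k.+1])%E)
    = (fun i => (M i k.+1)%:E).
  apply/funext => i; rewrite -expectation_Rintegral //; congr expectation.
  by apply/funext => w; rewrite esd_moment_fun.
rewrite -(fineK fin).
by apply: cvg_EFin; [exact: nearW|exact: cM].
Qed.
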